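(* Let $\bar x\in\mathcal R=\{x\in S:\ G(x)\subseteq C\}$ be a local weakly efficient solution to the vector optimization problem of minimizing $f$ (with respect to the cone $K$) over $\mathcal R$. Suppose that: (i) $S$ is locally convex around $\bar x$; (ii) $f$ is $K$-Lipschitz near $\bar x$, with constant $\ell_f>0$ and vector $e\in\mathrm{int}\,K\cap\mathbb B$, and $f$ is directionally differentiable at $\bar x$, with $f'(\bar x;\cdot):\mathbb X\to\mathbb Y$ being $K$-sublinear; (iii) $G$ is lower semicontinuous in a neighbourhood of $\bar x$ and metrically $C$-increasing around $\bar x$, relative to $S$; (iv) $G$ is $C$-bounded around $\bar x$ and Hausdorff upper semicontinuous at $\bar x$; (v) $G$ is $C$-concave on $\mathbb X$. Then for any $\alpha\in(1,\mathrm{inc}_C(G;S;\bar x))$ and any $\ell\ge\ell_f$ there exists $y^*\in K^{\oplus}\setminus\{\mathbf 0^*\}$ such that $$\langle y^*,f'(\bar x;v)\rangle+\frac{\ell}{\alpha-1}\langle y^*,\nu_{G,C}'(\bar x;v)\,e\rangle\ge0,\qquad\forall v\in \mathrm I(S;\bar x).$$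
   Context: Setting: $\mathbb X,\mathbb Y,\mathbb Z$ are real Banach spaces; $K\subseteq\mathbb Y$ is a (proper) convex cone with $\mathrm{int}\,K\neq\varnothing$, inducing the partial order $y_1\le_K y_2\iff y_2-y_1\in K$; $C\subseteq\mathbb Z$ is a proper closed convex cone, $C\neq\{\mathbf 0\}$; $S\subseteq\mathbb X$ is nonempty and closed; $f:\mathbb X\to\mathbb Y$ is a mapping; $G:\mathbb X\rightrightarrows\mathbb Z$ is a set-valued mapping with $G(x)\neq\varnothing$ for every $x\in\mathbb X$. $\mathrm B(x,r)$ is the closed ball with center $x$ and radius $r$, and $\mathbb B$ is the closed unit ball centered at $\mathbf 0$. For a set $A$, $\mathrm B(A,r)=\{z:\ \mathrm{dist}(z,A)\le r\}$ is its $r$-enlargement. $\mathbf 0^*$ is the null vector of the dual space, and $K^{\oplus}=\{y^*\in\mathbb Y^*:\ \langle y^*,y\rangle\ge0,\ \forall y\in K\}$. Local weak efficiency: $\bar x\in\mathcal R$ is a local weakly efficient solution to the problem of minimizing $f$ over $\mathcal R$ if there is $\delta>0$ with $f(\mathcal R\cap \mathrm B(\bar x,\delta))\cap[f(\bar x)-\mathrm{int}\,K]=\varnothing$. $S$ is locally convex around $\bar x$ if $S\cap \mathrm B(\bar x,r)$ is convex for some $r>0$. $f$ is $K$-Lipschitz near $\bar x$ with constant $\ell_f>0$ and vector $e\in\mathrm{int}\,K\cap\mathbb B$ if for some $\delta>0$: $f(x_1)\in f(x_2)-\ell_f\|x_1-x_2\|e+K$ for all $x_1,x_2\in \mathrm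 B(\bar x,\delta)$. $h'(\bar x;v)=\lim_{t\downarrow0}(h(\bar x+tv)-h(\bar x))/t$ is the directional derivative of $h$; $h$ is directionally differentiable at $\bar x$ if this exists for every $v\in\mathbb X$. A mapping $h:\mathbb X\to\mathbb Y$ is $K$-sublinear if it is positively homogeneous and $K$-convex, i.e. $\{(x,y)\in\mathbb X\times\mathbb Y:\ h(x)\le_K y\}$ is convex. $G$ is lower semicontinuous (l.s.c.) at $x$ if for every open $V$ with $V\cap G(x)\ne\varnothing$ there is a neighbourhood $U$ of $x$ with $G(u)\cap V\neq\varnothing$ for all $u\in U$. $G$ is Hausdorff upper semicontinuous at $\bar x$ if for every $\epsilon>0$ there is $\delta>0$ with $G(x)\subseteq \mathrm B(G(\bar x),\epsilon)$ for all $x\in \mathrm B(\bar x,\delta)$. $G$ is $C$-bounded around $\bar x$ if there is $\delta>0$ such that $G(x)\setminus C$ is bounded for every $x\in \mathrm B(\bar x,\delta)$. $G$ is $C$-concave on $\mathbb X$ if $G(tx_1+(1-t)x_2)\subseteq tG(x_1)+(1-t)G(x_2)+C$ for all $x_1,x_2\in\mathbb X$ and $t\in[0,1]$. $G$ is metrically $C$-increasing around $\bar x$, relative to $S$, if there exist $\delta>0$ and $\alpha>1$ such that $$(\ast)\quad\forall x\in \mathrm B(\bar x,\delta)\cap S,\ \forall r\in(0,\delta)\ \ \exists z\in \mathrm B(x,r)\cap S:\ \ \mathrm B(G(z),\alpha r)\subseteq \mathrm B(G(x)+C,r).$$ $\mathrm{inc}_C(G;S;\bar x)=\sup\{\alpha>1:\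 \exists\delta>0\text{ for which }(\ast)\text{ holds}\}$. Merit function: $\nu_{G,C}:\mathbb X\to[0,+\infty]$, $\nu_{G,C}(x)=\sup_{z\in G(x)}\mathrm{dist}(z,C)$. Feasible direction cone: $\mathrm I(S;\bar x)=\{v\in\mathbb X:\ \exists\delta>0:\ \bar x+tv\in S,\ \forall t\in(0,\delta)\}$. *)

(* Defs.v *)
From HB Require Import structures.
From mathcomp Require Import all_boot all_order all_algebra.
From mathcomp Require Import all_classical all_reals all_analysis.

Set Implicit Arguments.
Unset Strict Implicit.
Unset Printing Implicit Defensive.
Import Order.TTheory GRing.Theory Num.Theory.
Import numFieldNormedType.Exports.

Local Open Scope classical_set_scope.
Local Open Scope ring_scope.

Section Cones.
Context {R : realType} {V : normedModType R}.
Implicit Types (K : set V).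

Definition convex_cone K : Prop :=
  [/\ K !=set0, convex_set K & forall t y, 0 <= t -> K y -> K (t *: y)].

Definition proper_set K : Prop := K <> setT.

Definition cone_le K (y1 y2 : V) : Prop := K (y2 - y1).

(* The topological dual of V is the set of continuous functionals in
   {linear V -> R^o}. *)
Definition dual_cone K : set {linear V -> R^o} :=
  [set ys : {linear V -> R^o} | continuous ys /\ forall y, K y -> 0 <= (ys y : R)].

Definition locally_convex_around (S : set V) (x : V) : Prop :=
  exists2 r : R, 0 < r & convex_set (S `&` closed_ball x r).

Definition feasible_dir (S : set V) (x : V) : set V :=
  [set v | exists2 d : R, 0 < d & forall t : R, 0 < t < d -> S (x + t *: v)].

Definition minkowski_add (A B : set V) : set V :=
  [set a + b | a in A & b in B].

(* edist_inf A z is dist(z, A), with value +oo when A is empty. *)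
Definition enlargement (A : set V) (r : R) : set V :=
  [set z | (edist_inf A z <= r%:E)%E].

End Cones.

Section VectorMaps.
Context {R : realType} {X Y : normedModType R}.
Implicit Types (f h : X -> Y) (K : set Y) (x v : X).

Definition local_weakly_efficient f K (D : set X) (x : X) : Prop :=
  D x /\ exists2 d : R, 0 < d &
    f @` (D `&` closed_ball x d) `&` [set f x - k | k in K°] = set0.

Definition K_lipschitz_near f K x (l : R) (e : Y) : Prop :=
  exists2 d : R, 0 < d & forall x1 x2,
    closed_ball x d x1 -> closed_ball x d x2 ->
    exists2 k, K k & f x1 = f x2 - (l * `|x1 - x2|) *: e + k.

Definition diff_quot h x v (t : R) : Y := t^-1 *: (h (x + t *: v) - h x).

Definition dir_derivable h x : Prop :=
  forall v, cvg (diff_quot h x v t @[t --> 0^'+]).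

Definition dir_deriv h x v : Y := lim (diff_quot h x v t @[t --> 0^'+]).

Definition K_convex h K : Prop :=
  convex_set [set p : X * Y | cone_le K (h p.1) p.2].

Definition K_sublinear h K : Prop :=
  (forall (t : R) v, 0 < t -> h (t *: v) = t *: h v) /\ K_convex h K.

End VectorMaps.

Section SetValued.
Context {R : realType} {X Z : normedModType R}.
Implicit Types (G : X -> set Z) (C : set Z) (S : set X) (x v : X).

Definition lsc_at G x : Prop :=
  forall V : set Z, open V -> V `&` G x !=set0 ->
    \forall u \near x, G u `&` V !=set0.

Definition hausdorff_usc_at G x : Prop :=
  forall eps : R, 0 < eps -> exists2 d : R, 0 < d &
    forall u, closed_ball x d u -> G u `<=` enlargement (G x) eps.

Definition C_bounded_around G C x : Prop :=
  exists2 d : R, 0 < d &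
    forall u, closed_ball x d u -> bounded_set (G u `\` C).

Definition C_concave G C : Prop :=
  forall x1 x2 (t : R), 0 <= t <= 1 ->
    G (t *: x1 + (1 - t) *: x2) `<=`
    minkowski_add
      (minkowski_add [set t *: z | z in G x1] [set (1 - t) *: z | z in G x2]) C.

Definition C_increasing_with G C S x (a : R) : Prop :=
  exists2 d : R, 0 < d &
    forall u, (closed_ball x d `&` S) u -> forall r : R, 0 < r < d ->
      exists2 z, (closed_ball u r `&` S) z &
        enlargement (G z) (a * r) `<=` enlargement (minkowski_add (G u) C) r.

Definition metrically_C_increasing G C S x : Prop :=
  exists2 a : R, 1 < a & C_increasing_with G C S x a.

Definition incC G C S x : \bar R :=
  ereal_sup [set a%:E | a in [set a : R | 1 < a /\ C_increasing_with G C S x a]].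

Definition merit G C x : \bar R := ereal_sup [set edist_inf C z | z in G x].

(* merit G C takes values in the extended reals, so its directional derivative
   is the limit of difference quotients computed there; the predicate below
   says that this limit exists and equals the real number d. *)
Definition is_merit_dir_deriv G C x v (d : R) : Prop :=
  ((t^-1)%:E * (merit G C (x + t *: v)%R - merit G C x))%E @[t --> 0^'+]
    --> d%:E.

End SetValued.

(* Main.v *)
Require Import Defs.
From HB Require Import structures.
From mathcomp Require Import all_boot all_order all_algebra.
From mathcomp Require Import all_classical all_reals all_analysis.
From mathcomp Require Import ring lra.

Set Implicit Arguments.
Unset Strict Implicit.
Unset Printing Implicit Defensive.
Import Order.TTheory GRing.Theory Num.Theory.
Import numFieldNormedType.Exports.

Local Open Scope classical_set_scope.
Local Open Scope ring_scope.

(* An exact penalty argument.  If [u] in [S] is close to [xbar], a single use of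
   the increase property, with radius [merit u / (a - 1)], produces a feasible
   point within that distance of [u].  Combined with the K-Lipschitz bound on
   [f], this shows that no [u] in [S] near [xbar] improves
   [f + l / (alpha - 1) * merit * e] in the sense of [int K]; passing to
   difference quotients, [h v := f'(xbar; v) + l / (alpha - 1) * merit'(xbar; v) e]
   never lies in [- int K] for feasible [v].  As [h] is K-convex, the cone
   generated by the vectors [h v + k], with [k] in [K], is convex and omits
   [- e], so a continuous functional is nonnegative on it and positive at [e]. *)

(** * Convex cones and their interiors *)

Section ConvexSets.
Context {R : realType} {V : normedModType R}.
Implicit Types (A K : set V).

Lemma convex_setP A : convex_set A <->
  forall x y (t : R), 0 <= t <= 1 -> A x -> A y -> A (t *: x + (1 - t) *: y).
Proof.
split=> [cA x y t /andP[t0 t1] Ax Ay|cA x y t /set_mem Ax /set_mem Ay].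
  exact: set_mem (cA _ _ (Itv01 t0 t1) (mem_set Ax) (mem_set Ay)).
by apply/mem_set/cA => //; apply/andP.
Qed.

Lemma convex_cone0 K : convex_cone K -> K 0.
Proof. by move=> [[k Kk] _ Kscale]; rewrite -(scale0r k); exact: Kscale. Qed.

Lemma convex_coneD K x y : convex_cone K -> K x -> K y -> K (x + y).
Proof.
move=> [_ /convex_setP Kconv Kscale] Kx Ky.
have := Kscale 2 _ (ler0n _ _) (Kconv _ _ 2^-1 _ Kx Ky).
rewrite (_ : 2 *: _ = x + y); first by apply; lra.
by rewrite scalerDr !scalerA (_ : 2 * (1 - 2^-1) = 1) ?mulfV ?scale1r //; lra.
Qed.

Lemma convex_coneZ K x (t : R) : convex_cone K -> 0 <= t -> K x -> K (t *: x).
Proof. by move=> [_ _ Kscale]; exact: Kscale. Qed.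

Lemma convex_coneI K : K 0 -> (forall x y, K x -> K y -> K (x + y)) ->
  (forall x (t : R), 0 < t -> K x -> K (t *: x)) -> convex_cone K.
Proof.
move=> K0 KD Kpos.
have Kscale (t : R) x : 0 <= t -> K x -> K (t *: x).
  by rewrite le_eqVlt => /orP[/eqP<- _|t0]; [rewrite scale0r|exact: Kpos].
split=> //; first by exists 0.
apply/convex_setP => x y t /andP[t0 t1] Kx Ky.
by apply: KD; apply: Kscale; rewrite // subr_ge0.
Qed.

Lemma interiorP A x :
  A° x <-> exists2 r : R, 0 < r & forall y, `|y| <= r -> A (x + y).
Proof.
split=> [/nbhs_closedballP[r xrA]|[r r0 rA]].
  exists r%:num => // y yr; apply: xrA; rewrite closed_ballE//.
  by rewrite /closed_ball_/= opprD addNKr normrN.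
apply/nbhs_closedballP; exists (PosNum r0) => y.
rewrite closed_ballE// /closed_ball_/= distrC => /rA.
by rewrite addrC subrK.
Qed.

Lemma interior_coneD K x y : convex_cone K -> K° x -> K y -> K° (x + y).
Proof.
move=> Kcone /interiorP[r r0 rK] Ky; apply/interiorP; exists r => // z /rK Kz.
by rewrite addrAC; exact: convex_coneD.
Qed.

Lemma interior_coneZ K x (t : R) :
  convex_cone K -> 0 < t -> K° x -> K° (t *: x).
Proof.
move=> Kcone t0 /interiorP[r r0 rK]; apply/interiorP.
exists (t * r) => [|y yr]; first exact: mulr_gt0.
rewrite (_ : _ + y = t *: (x + t^-1 *: y)).
  apply: convex_coneZ => //; first exact: ltW.
  by apply: rK; rewrite normrZ gtr0_norm ?invr_gt0// ler_pdivrMl.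
by rewrite scalerDr scalerA divff ?scale1r// gt_eqF.
Qed.

(** A ball around 0 contained in a cone is scaled up to cover every vector. *)
Lemma interior_cone_neq0 K : convex_cone K -> proper_set K -> ~ K° 0.
Proof.
move=> Kcone Kproper /interiorP[r r0 rK]; apply: Kproper.
rewrite -subTset => y _; have [->|y0] := eqVneq y 0; first exact: convex_cone0.
have ny : 0 < `|y| by rewrite normr_gt0.
rewrite (_ : y = (`|y| / r) *: (0 + (r / `|y|) *: y)).
  apply: convex_coneZ => //; first by rewrite divr_ge0// ltW.
  by apply: rK; rewrite normrZ gtr0_norm ?divr_gt0// divfK ?gt_eqF.
by rewrite add0r scalerA mulrA divfK ?divff ?scale1r// gt_eqF.
Qed.

End ConvexSets.

(** * Separation of a point from a convex cone, by Zorn's lemma *)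

Section ConeSeparation.
Context {R : realType} {V : normedModType R}.
Implicit Types (Q M : set V) (e : V).

(* The alternative [M y \/ M (- y)] makes [y |-> inf {t | M (t e - y)}] linear
   rather than merely sublinear. *)
Lemma maximal_cone Q e : convex_cone Q -> ~ Q (- e) ->
  exists M, [/\ convex_cone M, Q `<=` M, ~ M (- e)
    & forall y, M y \/ M (- y)].
Proof.
move=> Qcone QNe.
pose P M := [/\ convex_cone M, Q `<=` M & ~ M (- e)].
have [F FP Ftot|M [MP Mmax]] := @Zorn_bigcup V (fun M => M = set0 \/ P M).
  have [[M FM [m Mm]]|F0] := pselect (exists2 M, F M & M !=set0); last first.
    left; rewrite -subset0 => x [M FM Mx].
    by apply: F0; exists M => //; exists x.
  right.
  have PM N : F N -> N !=set0 -> P N by move=> /FP[->|//] [].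
  have [Mcone QM MNe] : P M by apply: (PM) => //; exists m.
  split.
  - apply: convex_coneI.
    + by exists M => //; exact: convex_cone0.
    + move=> x y [A FA Ax] [B FB By].
      have [Acone _ _] : P A by apply: (PM) => //; exists x.
      have [Bcone _ _] : P B by apply: (PM) => //; exists y.
      have [AB|BA] := Ftot _ _ FA FB.
        by exists B => //; apply: convex_coneD => //; exact: AB.
      by exists A => //; apply: convex_coneD => //; exact: BA.
    + move=> x t t0 [A FA Ax]; exists A => //.
      have [Acone _ _] : P A by apply: (PM) => //; exists x.
      by apply: convex_coneZ => //; exact: ltW.
  - by move=> x Qx; exists M => //; exact: QM.
  - move=> [A FA Ae].
    by have [_ _] : P A by apply: (PM) => //; exists (- e).
have {MP} [Mcone QM MNe] : P M.
  case: MP => // M0; have [] := Mmax Q; last by right; split.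
  rewrite M0; split; first exact: sub0set.
  by move=> /(_ _ (convex_cone0 Qcone)).
exists M; split=> // y; apply: contrapT => /not_orP[My MNy].
(* If [z] is outside [M], the cone [M + R+ z] is strictly larger, so by maximality it contains
   [- e]; the coefficient of [z] is positive as [M] omits [- e]. *)
have extend z : ~ M z ->
    exists m (s : R), [/\ M m, 0 < s & - e = m + s *: z].
  move=> Mz; pose N := [set x | exists m (s : R), [/\ M m, 0 <= s & x = m + s *: z]].
  have Ncone : convex_cone N.
    apply: convex_coneI.
    - by exists 0, 0; split; rewrite ?scale0r ?addr0//; exact: convex_cone0.
    - move=> _ _ [m1 [s1 [Mm1 s10 ->]]] [m2 [s2 [Mm2 s20 ->]]].
      exists (m1 + m2), (s1 + s2); split; first exact: convex_coneD.
      + exact: addr_ge0.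
      + by rewrite scalerDl addrACA.
    - move=> _ t t0 [m [s [Mm s0 ->]]].
      exists (t *: m), (t * s); split; first exact: (convex_coneZ Mcone (ltW t0)).
      + by rewrite mulr_ge0// ltW.
      + by rewrite scalerDr scalerA.
  have MN : M `<=` N.
    by move=> x Mx; exists x, 0; rewrite scale0r addr0.
  have Nz : N z.
    by exists 0, 1; rewrite scale1r add0r ler01; split=> //; exact: convex_cone0.
  have [|NNe] := pselect (N (- e)); last first.
    case: (Mmax N); last by right; split=> //; exact: subset_trans MN.
    by split=> // /(_ _ Nz).
  move=> [m [s [Mm]]]; rewrite le_eqVlt => /orP[/eqP<-|s0 ->].
    by rewrite scale0r addr0 => NeE; case: MNe; rewrite NeE.
  by exists m, s.
have [m1 [s1 [Mm1 s10 e1]]] := extend _ My.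
have [m2 [s2 [Mm2 s20 e2]]] := extend _ MNy.
(* The weights [s2] and [s1] cancel [y] between the two representations of [- e]. *)
apply: MNe; rewrite (_ : - e = (s1 + s2)^-1 *: (s2 *: m1 + s1 *: m2)).
  apply: (convex_coneZ Mcone); first by rewrite invr_ge0 addr_ge0// ltW.
  by apply: (convex_coneD Mcone); apply: (convex_coneZ Mcone) => //; exact: ltW.
have -> : m1 = - e - s1 *: y by rewrite e1 addrK.
have -> : m2 = - e + s2 *: y by rewrite e2 scalerN subrK.
rewrite [X in _ *: X](_ : _ = (s1 + s2) *: - e).
  by rewrite scalerA mulVf ?scale1r// gt_eqF// addr_gt0.
rewrite scalerBr scalerDr !scalerA (mulrC s2 s1) addrACA addNr addr0.
by rewrite -scalerDl addrC.
Qed.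

(** The functional is [phi y = inf {t | M (t e - y)}] for a maximal cone [M] above [Q]. That [e] is
    interior makes [phi] finite with [|phi y| <= |y| / r]; totality of [M] turns the infimum into a
    two-sided cut, whence linearity. *)
Lemma cone_separation Q e : convex_cone Q -> Q° e -> ~ Q (- e) ->
  exists phi : {linear V -> R^o},
    [/\ continuous phi, forall y, Q y -> 0 <= (phi y : R) & phi e = 1].
Proof.
move=> Qcone /interiorP[r r0 rQ] QNe.
have [M [Mcone QM MNe Mtot]] := maximal_cone Qcone QNe.
have MD x y := @convex_coneD _ _ M x y Mcone.
have MZ x t := @convex_coneZ _ _ M x t Mcone.
have Mlarge y (s : R) : `|y| <= s * r -> M (s *: e + y).
  move=> ys.
  have s0 : 0 <= s by rewrite -(pmulr_lge0 _ r0) (le_trans _ ys).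
  move: s0 ys; rewrite le_eqVlt => /orP[/eqP<-|s0 ys].
    rewrite mul0r normr_le0 => /eqP->; rewrite scale0r addr0; exact: convex_cone0.
  rewrite (_ : _ + y = s *: (e + s^-1 *: y)).
    apply: (MZ _ _ (ltW s0)); apply/QM/rQ.
    by rewrite normrZ gtr0_norm ?invr_gt0// ler_pdivrMl.
  by rewrite scalerDr scalerA divff ?scale1r// gt_eqF.
have Mge0 (t : R) : M (t *: e) -> 0 <= t.
  move=> Mt; rewrite leNgt; apply/negP => t0; apply: MNe.
  have := MZ _ (- t^-1) _ Mt; rewrite scalerA mulNr mulVf ?lt_eqF// scaleN1r.
  by apply; rewrite oppr_ge0 invr_le0 ltW.
have e0 : M e by rewrite -(addr0 e); apply/QM/rQ; rewrite normr0 ltW.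
pose U y := [set t : R | M (t *: e - y)].
have Ul y t s : M (y - s *: e) -> U y t -> s <= t.
  move=> Ms /MD /(_ Ms); rewrite addrA subrK -scalerBl => /Mge0.
  by rewrite subr_ge0.
pose phi y : R := inf (U y).
have U0 y : U y !=set0.
  exists (`|y| / r); rewrite /U/=; apply: Mlarge.
  by rewrite normrN divfK// gt_eqF.
have Ulb y : has_lbound (U y).
  exists (- (`|y| / r)) => t; apply: Ul; rewrite scaleNr opprK addrC.
  by apply: Mlarge; rewrite divfK// gt_eqF.
have phi_le y t : M (t *: e - y) -> phi y <= t by exact: ge_inf.
have phi_ge y t : M (y - t *: e) -> t <= phi y.
  by move=> Mt; apply: lb_le_inf => // s; exact: Ul.
have phi_gt y t : phi y < t -> M (t *: e - y).
  move=> yt; have [//|] := Mtot (t *: e - y).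
  by rewrite opprB => /phi_ge; rewrite leNgt yt.
have phi_lt y t : t < phi y -> M (y - t *: e).
  move=> yt; have [//|] := Mtot (y - t *: e).
  by rewrite opprB => /phi_le; rewrite leNgt yt.
(* The value is identified by strict inequalities on both sides, because [M] need not be closed and
   the infimum need not be attained. *)
have phiE y a : (forall t, a < t -> M (t *: e - y)) ->
    (forall t, t < a -> M (y - t *: e)) -> phi y = a.
  move=> gta lta; apply/le_anti/andP; split; apply/ler_addgt0Pr => eps eps0.
    by apply/phi_le/gta; rewrite ltrDl.
  by rewrite -lerBlDr; apply/phi_ge/lta; rewrite ltrBlDr ltrDl.
have phiD x y : phi (x + y) = phi x + phi y.
  apply: phiE => t.
    move=> xyt; pose d := (t - (phi x + phi y)) / 2.
    rewrite (_ : _ - _ = ((phi x + d) *: e - x) + ((phi y + d) *: e - y)).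
      by apply: MD; apply: phi_gt; rewrite ltrDl /d; lra.
    by rewrite addrACA -scalerDl opprD; congr (_ *: _ + _); rewrite /d; field.
  move=> xyt; pose d := ((phi x + phi y) - t) / 2.
  rewrite (_ : _ - _ = (x - (phi x - d) *: e) + (y - (phi y - d) *: e)).
    by apply: MD; apply: phi_lt; rewrite ltrBlDr ltrDl /d; lra.
  by rewrite addrACA -opprD -scalerDl; congr (_ - _ *: _); rewrite /d; field.
have phiN x : phi (- x) = - phi x.
  apply: phiE => t xt; rewrite ?(opprK x).
    rewrite addrC -(opprK t) scaleNr; apply: phi_lt.
    by rewrite ltrNl.
  by rewrite -opprD addrC opprD -scaleNr; apply: phi_gt; rewrite ltrNr.
have phiZp (k : R) x : 0 < k -> phi (k *: x) = k * phi x.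
  move=> k0; apply: phiE => t xt.
    rewrite (_ : _ - _ = k *: ((k^-1 * t) *: e - x)).
      by apply: (MZ _ _ (ltW k0)); apply: phi_gt; rewrite ltr_pdivlMl.
    by rewrite scalerBr scalerA mulrA divff ?mul1r// gt_eqF.
  rewrite (_ : _ - _ = k *: (x - (k^-1 * t) *: e)).
    by apply: (MZ _ _ (ltW k0)); apply: phi_lt; rewrite ltr_pdivrMl.
  by rewrite scalerBr scalerA mulrA divff ?mul1r// gt_eqF.
have phi_lin : linear (phi : V -> R^o).
  move=> k x y; rewrite phiD; congr (_ + _).
  have [k0|k0|->] := ltgtP k 0; last 1 first.
  - by rewrite !scale0r -(subrr 0) phiD phiN subrr.
  - by rewrite -[LHS]opprK -phiN -scaleNr phiZp ?oppr_gt0// mulNr opprK.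
  - exact: phiZp.
have phi_bound y : `|phi y| <= `|y| / r.
  rewrite ler_norml; apply/andP; split.
    by apply: phi_ge; rewrite scaleNr opprK addrC; apply: Mlarge; rewrite divfK ?gt_eqF.
  by apply: phi_le; apply: Mlarge; rewrite normrN divfK ?gt_eqF.
pose phiL : {linear V -> R^o} :=
  HB.pack (phi : V -> R^o) (GRing.isLinear.Build _ _ _ _ _ phi_lin).
exists phiL; split.
- apply: bounded_linear_continuous; apply/linear_boundedP.
  near=> C => y; apply: le_trans (phi_bound y) _.
  by rewrite mulrC ler_wpM2r//; near: C; exact: nbhs_pinfty_ge.
- by move=> y Qy; rewrite /phiL/=; apply: phi_ge; rewrite scale0r subr0; exact: QM.
- rewrite /phiL/=; apply: phiE => t t1; [rewrite -[X in _ - X]scale1r -scalerBl|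
    rewrite -[X in X - _]scale1r -scalerBl]; 
    by apply: (MZ _ _ _ e0); rewrite subr_ge0 ltW.
Unshelve. all: by end_near. Qed.

End ConeSeparation.

(** * Distance to a convex set *)

Section Distance.
Context {R : realType} {V : normedModType R}.
Implicit Types (A C : set V) (x y : V).

Lemma edist_ltP x y (r : R) : (edist (x, y) < r%:E)%E <-> `|x - y| < r.
Proof.
split=> [/edist_lt_ball|xyr]; first by rewrite /= -ball_normE.
have [s xys sr] : exists2 s : R, `|x - y| < s & s < r.
  by exists ((`|x - y| + r) / 2); lra.
apply: (@le_lt_trans _ _ s%:E); last by rewrite lte_fin.
by apply: edist_fin => /=; rewrite -?ball_normE//; exact: le_lt_trans xys.
Qed.

(** The slack [eps] accounts for an infimum that need not be attained; distance bounds become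
    statements about actual points of [A]. *)
Lemma edist_inf_leP A x (m : R) : (edist_inf A x <= m%:E)%E <->
  forall eps : R, 0 < eps -> exists2 a, A a & `|x - a| < m + eps.
Proof.
split=> [xm eps eps0|xm].
  have /ereal_inf_lt[_ [a Aa <-] /edist_ltP xa] : (edist_inf A x < (m + eps)%:E)%E.
    by rewrite (le_lt_trans xm)// lte_fin ltrDl.
  by exists a.
apply/lee_addgt0Pr => eps /xm[a Aa /edist_ltP/ltW]; apply: le_trans.
by apply: ereal_inf_lbound; exists a.
Qed.

Lemma edist_inf_leW A x a (m : R) : A a -> `|x - a| <= m ->
  (edist_inf A x <= m%:E)%E.
Proof.
move=> Aa xa; apply/edist_inf_leP => eps eps0; exists a => //.
by rewrite (le_lt_trans xa)// ltrDl.
Qed.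

Lemma closed_edist_inf_le0 C x : closed C -> (edist_inf C x <= 0)%E -> C x.
Proof.
move=> Cclosed /edist_inf_leP x0; rewrite (iffLR (closure_id C) Cclosed).
move=> B /nbhs_ballP[eps/= /x0[a Ca]]; rewrite add0r => xa epsB.
by exists a; split=> //; apply: epsB; rewrite -ball_normE.
Qed.

(* The distance to a convex set grows at unit rate along rays leaving the set,
   so it cannot stay below [rho] on a whole ball of radius [rho] around a
   point outside the set. *)
Lemma edist_inf_ball_mem C y (rho : R) : closed C -> convex_set C ->
  C !=set0 -> 0 < rho ->
  (forall w, `|w - y| <= rho -> (edist_inf C w <= rho%:E)%E) -> C y.
Proof.
move=> Cclosed /convex_setP Cconv [c0 Cc0] rho0 yC.
apply: closed_edist_inf_le0 => //; apply/edist_inf_leP => eps eps0.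
rewrite add0r; apply: contrapT => yNC.
have yeps c : C c -> eps <= `|y - c|.
  by move=> Cc; rewrite leNgt; apply/negP => yc; apply: yNC; exists c.
pose D := [set `|y - c| | c in C].
have D0 : D !=set0 by exists `|y - c0|; exists c0.
have Dlb : has_lbound D by exists eps => _ [c /yeps ? <-].
pose s := inf D.
have s0 : 0 < s.
  by apply: (lt_le_trans eps0); apply: lb_le_inf => // _ [c /yeps ? <-].
have sy c : C c -> s <= `|y - c| by move=> Cc; apply: ge_inf => //; exists c.
(* With [tau = rho / k] and [k >= s], this slack [eta] gives [tau * eta <= s / 2], while the ray
   argument below gives [s / 2 < tau * eta]. *)
have eta0 : 0 < s * s / (2 * rho) by rewrite divr_gt0 ?mulr_gt0.
have [_ [c Cc <-] yc] := inf_adherent eta0 (conj D0 Dlb).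
rewrite -/s in yc; set k := `|y - c| in yc.
have sk : s <= k by exact: sy.
have k0 : 0 < k by exact: lt_le_trans sk.
pose tau := rho / k.
have tau0 : 0 < tau by rewrite divr_gt0.
have s20 : 0 < s / 2 by rewrite divr_gt0.
have wrho : `|y + tau *: (y - c) - y| <= rho.
  by rewrite addrAC subrr add0r normrZ gtr0_norm// divfK ?gt_eqF.
have /edist_inf_leP/(_ _ s20)[d Cd wd] := yC _ wrho.
have t01 : 0 <= (1 + tau)^-1 <= 1.
  by rewrite invr_ge0 invf_le1 ?lerDl; lra.
(* [y] is the combination of [w = y + tau (y - c)] and [c] with weights [1 / (1 + tau)] and
   [tau / (1 + tau)]; putting [d] in place of [w] gives a point of [C] at distance
   [|w - d| / (1 + tau)] from [y]. *)
have := sy _ (Cconv d c _ t01 Cd Cc).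
have -> : y - ((1 + tau)^-1 *: d + (1 - (1 + tau)^-1) *: c) =
    (1 + tau)^-1 *: (y + tau *: (y - c) - d).
  rewrite scalerBr [in RHS]scalerDr !scalerA scalerBr.
  have -> : (1 + tau)^-1 * tau = 1 - (1 + tau)^-1 by field; lra.
  move: ((1 + tau)^-1) => p.
  by rewrite addrA -scalerDl (addrC p) subrK scale1r opprD addrA addrAC.
rewrite normrZ ger0_norm; last by case/andP: t01.
rewrite ler_pdivlMl; last lra.
move=> /le_lt_trans/(_ wd) swd.
have tauk : tau * k = rho by rewrite /tau divfK ?gt_eqF.
have : s * s / (2 * rho) * (2 * rho) = s * s.
  by rewrite divfK// gt_eqF// mulr_gt0.
move: (s * s / _) yc eta0 => eta yc eta0 etaE.
have taueta : s * (tau * eta) <= k * (tau * eta).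
  by rewrite ler_wpM2r// mulr_ge0// ltW.
have taus : tau * k < tau * s + tau * eta by rewrite -mulrDr ltr_pM2l.
have : k * (tau * eta) = rho * eta by rewrite -tauk; ring.
have : s * (s / 2) < s * (tau * eta).
  by rewrite ltr_pM2l//; lra.
nra.
Qed.
End Distance.

Lemma closed_ball_normP {R : realType} {V : normedModType R} (x y : V) (r : R) :
  0 < r -> closed_ball x r y <-> `|y - x| <= r.
Proof. by move=> r0; rewrite closed_ballE// /closed_ball_/= distrC. Qed.

(** * The merit function and an error bound *)

Section Merit.
Context {R : realType} {X Z : normedModType R}.
Implicit Types (G : X -> set Z) (C : set Z) (S : set X) (x u v : X).

Lemma merit_leP G C x (m : R) :
  (merit G C x <= m%:E)%E <-> forall z, G x z -> (edist_inf C z <= m%:E)%E.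
Proof.
split=> [xm z Gz|xm]; last by apply: ge_ereal_sup => _ [z /xm ? <-].
by apply: le_trans xm; apply: ereal_sup_ubound; exists z.
Qed.

(** Nonemptiness excludes the supremum of the empty set, which is [-oo]. *)
Lemma merit_ge0 G C x : G x !=set0 -> (0 <= merit G C x)%E.
Proof.
move=> [z Gz]; apply: le_ereal_sup_tmp.
by exists (edist_inf C z); [exists z|exact: edist_inf_ge0].
Qed.

Lemma merit_le0 G C x : G x `<=` C -> (merit G C x <= 0)%E.
Proof. by move=> GC; apply/merit_leP => z /GC Cz; rewrite edist_inf0. Qed.

Lemma merit_le0_sub G C x : closed C -> (merit G C x <= 0)%E -> G x `<=` C.
Proof. by move=> Cclosed /merit_leP Gx z /Gx /closed_edist_inf_le0; exact. Qed.

(** By [C]-concavity, a point of [G] at the combination is [t z1 + (1 - t) z2 + c], and adding [c]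
    in [C] does not increase the distance to the cone [C]. The real bounds [m1] and [m2] avoid
    arithmetic with infinite values. *)
Lemma merit_convex G C x1 x2 (m1 m2 t : R) : convex_cone C -> C_concave G C ->
  0 <= t <= 1 -> (merit G C x1 <= m1%:E)%E -> (merit G C x2 <= m2%:E)%E ->
  (merit G C (t *: x1 + (1 - t) *: x2)%R <= (t * m1 + (1 - t) * m2)%:E)%E.
Proof.
move=> Ccone Gconc t01 /merit_leP m1P /merit_leP m2P; apply/merit_leP => z.
move=> /(Gconc _ _ _ t01)[_ [_ [z1 Gz1 <-] [_ [z2 Gz2 <-] <-]] [c Cc <-]].
move: t01 => /andP[t0 t1]; rewrite -subr_ge0 in t1.
apply/edist_inf_leP => eps eps0; have eps20 : 0 < eps / 2 by lra.
have /edist_inf_leP/(_ _ eps20)[c1 Cc1 zc1] := m1P _ Gz1.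
have /edist_inf_leP/(_ _ eps20)[c2 Cc2 zc2] := m2P _ Gz2.
exists (t *: c1 + (1 - t) *: c2 + c).
  by apply: convex_coneD => //; apply: convex_coneD => //; exact: convex_coneZ.
rewrite opprD addrACA subrr addr0 opprD addrACA -!scalerBr.
apply: le_lt_trans (ler_normD _ _) _; rewrite !normrZ !ger0_norm//.
apply: (@le_lt_trans _ _ (t * (m1 + eps / 2) + (1 - t) * (m2 + eps / 2))).
  by rewrite lerD// ler_wpM2l// ltW.
lra.
Qed.

(** As [G x] lies in [C], an enlargement of [G x] lies in the enlargement of [C] of the same
    radius. *)
Lemma merit_usc G C x (eps : R) : hausdorff_usc_at G x -> G x `<=` C ->
  0 < eps -> exists2 d : R, 0 < d &
    forall u, `|u - x| <= d -> (merit G C u <= eps%:E)%E.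
Proof.
move=> Gusc GC /Gusc[d d0 Gd]; exists d => // u /(closed_ball_normP _ _ d0) ud.
apply/merit_leP => z /(Gd _ ud) /edist_inf_leP zG.
by apply/edist_inf_leP => eta /zG[a /GC Ca]; exists a.
Qed.

(* One application of the increase property with radius
   [merit u / (a - 1)] already lands in the feasible set. *)
Lemma merit_error_bound G C S x (a : R) : convex_cone C -> closed C ->
  (forall u, G u !=set0) -> 1 < a -> C_increasing_with G C S x a ->
  exists2 d : R, 0 < d & forall u (m : R), S u -> `|u - x| <= d ->
    merit G C u = m%:E -> m < d * (a - 1) ->
    exists z, [/\ S z, G z `<=` C & `|z - u| <= m / (a - 1)].
Proof.
move=> Ccone Cclosed G0 a1 [d d0 inc]; exists d => // u m Su ud um md.
have a10 : 0 < a - 1 by lra.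
have : 0 <= m by rewrite -lee_fin -um merit_ge0.
(* If [m = 0] the radius would be 0, which the increase property excludes; [u] itself is then
   feasible. *)
rewrite le_eqVlt => /orP[/eqP m0|m0].
  exists u; rewrite subrr normr0 -m0 mul0r lexx; split=> //.
  by apply: merit_le0_sub => //; rewrite um -m0.
set r := m / (a - 1).
have r0 : 0 < r by rewrite divr_gt0.
have rd : r < d by rewrite ltr_pdivrMr.
have ball_u : (closed_ball x d `&` S) u by split=> //; apply/closed_ball_normP.
have [|z [zr Sz] Gz] := inc u ball_u r; first by rewrite r0.
exists z; split=> //; last exact/closed_ball_normP.
(* [r] is chosen to solve this equation: a point within [a r] of [G z] is within [r] of [G u + C],
   hence within [m + r = a r] of [C], so [edist_inf_ball_mem] applies to each point of [G z]. *)
have ar : a * r = m + r.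
  by rewrite -(divfK (lt0r_neq0 a10) m) -/r; ring.
move=> y Gy; apply: (edist_inf_ball_mem (rho := a * r)) => //.
- by case: Ccone.
- by case: Ccone.
- by rewrite mulr_gt0//; lra.
move=> w wy; apply/edist_inf_leP => eps eps0.
have eps20 : 0 < eps / 2 by lra.
have /Gz/edist_inf_leP/(_ _ eps20)[_ [g Gg [c Cc <-]] wgc] :
  enlargement (G z) (a * r) w by exact: edist_inf_leW Gy wy.
have /merit_leP/(_ _ Gg)/edist_inf_leP/(_ _ eps20)[c1 Cc1 gc1] :
  (merit G C u <= m%:E)%E by rewrite um.
exists (c1 + c); first exact: convex_coneD.
rewrite (_ : w - _ = (w - (g + c)) + (g - c1)).
  by rewrite (le_lt_trans (ler_normD _ _))//; lra.
by rewrite opprD [in RHS]opprD (addrC (- g)) !addrA subrK addrAC.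
Qed.

End Merit.

(** * Directional derivative of the merit function at a feasible point *)

Section MeritDirDeriv.
Context {R : realType} {X Z : normedModType R}.
Variables (G : X -> set Z) (C : set Z) (x : X).
Hypotheses (Ccone : convex_cone C) (Gconc : C_concave G C).
Hypotheses (G0 : forall u, G u !=set0) (GxC : G x `<=` C).
Hypothesis Gusc : hausdorff_usc_at G x.

Lemma near_ray {V : normedModType R} (y v : V) (d : R) : 0 < d ->
  \forall t \near (0 : R)^'+, `|y + t *: v - y| <= d.
Proof.
move=> d0; near=> t.
have t0 : 0 < t by near: t; exact: nbhs_right_gt.
rewrite addrAC subrr add0r normrZ gtr0_norm//.
rewrite -(mulr1 d); have v1 : 0 < `|v| + 1 by rewrite ltr_wpDl.
have : t <= d / (`|v| + 1).
  by near: t; apply: nbhs_right_le; rewrite divr_gt0.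
rewrite ler_pdivlMr// mulr1; apply: le_trans.
by rewrite ler_wpM2l ?lerDl// ltW.
Unshelve. all: by end_near. Qed.

(** [fine] sends [+oo] to 0; this is harmless where [merit] is finite, which holds near [x] by
    [merit_usc]. *)
Let nu u : R := fine (merit G C u).

Lemma merit_at0 : merit G C x = 0%E.
Proof. by apply/le_anti; rewrite merit_le0//= merit_ge0. Qed.

Lemma merit_ray_fin v : \forall t \near (0 : R)^'+,
  merit G C (x + t *: v) = (nu (x + t *: v))%:E.
Proof.
have [d d0 dP] := merit_usc Gusc GxC ltr01.
near=> t; rewrite /nu fineK// ge0_fin_numE ?merit_ge0//.
apply: le_lt_trans (ltry 1); apply: dP.
by near: t; exact: near_ray.
Unshelve. all: by end_near. Qed.

(** No term [merit G C x] is subtracted, since it is 0 by [merit_at0]. *)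
Definition merit_quot v (t : R) : R := t^-1 * fine (merit G C (x + t *: v)).

(** Convexity of the merit function along the ray and its value 0 at [x] make the quotient
    nondecreasing in small [t]; being bounded below by 0, it has a right limit at 0. *)
Lemma merit_quot_cvg v : cvg (merit_quot v t @[t --> 0^'+]).
Proof.
have nu0 u : 0 <= nu u by rewrite /nu fine_ge0// merit_ge0.
have [d d0 dP] := merit_usc Gusc GxC ltr01.
have v1 : 0 < `|v| + 1 by rewrite ltr_wpDl.
have fin t : 0 < t -> t < d / (`|v| + 1) ->
    merit G C (x + t *: v) = (nu (x + t *: v))%:E.
  move=> t0 td; rewrite /nu fineK// ge0_fin_numE ?merit_ge0//.
  apply: le_lt_trans (ltry 1); apply: dP.
  rewrite addrAC subrr add0r normrZ gtr0_norm//.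
  by move: td; rewrite ltr_pdivlMr// mulrDr => td; lra.
apply: nondecreasing_at_right_is_cvgr; near=> b.
  move=> s t; rewrite !in_itv/= => /andP[s0 sb] /andP[t0 tb] st.
  have bd : b <= d / (`|v| + 1).
    by near: b; apply: nbhs_right_le; rewrite divr_gt0.
  have finv r : 0 < r -> r < b -> merit G C (x + r *: v) = (nu (x + r *: v))%:E.
    by move=> r0 rb; apply: fin => //; exact: lt_le_trans bd.
  rewrite /merit_quot -/(nu _) -/(nu _) ler_pdivrMl// mulrA.
  have st01 : 0 <= s / t <= 1 by rewrite divr_ge0 ?ler_pdivrMr ?mul1r// ltW.
  (* [x + s v] is the combination of [x + t v] and [x] with weight [s / t]. *)
  have := @merit_convex _ _ _ G C (x + t *: v) x (nu (x + t *: v)) 0 (s / t)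
    Ccone Gconc st01.
  rewrite merit_at0 finv// mulr0 addr0 => /(_ (lexx _) (lexx _)).
  rewrite (_ : _ + (1 - s / t) *: x = x + s *: v) ?finv ?lee_fin//.
  rewrite scalerDr scalerA divfK ?gt_eqF// addrAC -scalerDl.
  by rewrite (addrC (s / t)) subrK scale1r.
exists 0 => _ [t /= /andP[t0 _] <-].
by rewrite /merit_quot mulr_ge0// ?invr_ge0 ?(ltW t0)// nu0.
Unshelve. all: by end_near. Qed.

Definition merit_dir_deriv v : R := lim (merit_quot v t @[t --> 0^'+]).

Lemma merit_quot_cvg_to v : merit_quot v t @[t --> 0^'+] --> merit_dir_deriv v.
Proof. exact: merit_quot_cvg. Qed.

Lemma merit_dir_derivP v : is_merit_dir_deriv G C x v (merit_dir_deriv v).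
Proof.
rewrite /is_merit_dir_deriv merit_at0.
have quotE : \forall t \near (0 : R)^'+,
    ((t^-1)%:E * (merit G C (x + t *: v)%R - 0))%E = (merit_quot v t)%:E.
  have := merit_ray_fin v; apply: filterS => t tv.
  by rewrite sube0 tv /merit_quot EFinM tv.
apply: cvg_EFin; first by apply: filterS quotE => t ->.
apply: cvg_trans (@merit_quot_cvg_to v); apply: near_eq_cvg.
by apply: filterS quotE => t /= ->.
Qed.

Lemma merit_dir_deriv0 : merit_dir_deriv 0 = 0.
Proof.
rewrite /merit_dir_deriv (_ : merit_quot 0 = fun=> 0) ?lim_cst//.
by apply/funext => t; rewrite /merit_quot scaler0 addr0 merit_at0 mulr0.
Qed.

(** The convexity inequality for [merit] at [x + s v] and [x + s w] is divided by [s] and passes to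
    the limit. *)
Lemma merit_dir_deriv_convex v w (t : R) : 0 <= t <= 1 ->
  merit_dir_deriv (t *: v + (1 - t) *: w) <=
  t * merit_dir_deriv v + (1 - t) * merit_dir_deriv w.
Proof.
move=> t01.
have cvw : (t * merit_quot v s + (1 - t) * merit_quot w s) @[s --> 0^'+]
    --> t * merit_dir_deriv v + (1 - t) * merit_dir_deriv w.
  by apply: cvgD; apply: cvgMl_tmp; exact: merit_quot_cvg_to.
apply: (ler_cvg_to (@merit_quot_cvg_to _) cvw).
near=> s.
have s0 : 0 < s by near: s; exact: nbhs_right_gt.
have sv : merit G C (x + s *: v) = (nu (x + s *: v))%:E.
  by near: s; exact: merit_ray_fin.
have sw : merit G C (x + s *: w) = (nu (x + s *: w))%:E.
  by near: s; exact: merit_ray_fin.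
have svw : merit G C (x + s *: (t *: v + (1 - t) *: w)) =
    (nu (x + s *: (t *: v + (1 - t) *: w)))%:E.
  by near: s; exact: merit_ray_fin.
have := @merit_convex _ _ _ G C (x + s *: v) (x + s *: w)
  (nu (x + s *: v)) (nu (x + s *: w)) t Ccone Gconc t01.
rewrite sv sw => /(_ (lexx _) (lexx _)).
rewrite (_ : _ + (1 - t) *: (x + s *: w) = x + s *: (t *: v + (1 - t) *: w)).
  rewrite svw lee_fin /merit_quot -!/(nu _) /= => le.
  by rewrite mulrCA (mulrCA (1 - t)) -mulrDr ler_wpM2l// invr_ge0 ltW.
rewrite !scalerDr addrACA -scalerDl (addrC t) subrK scale1r.
by rewrite !scalerA !(mulrC s).
Unshelve. all: by end_near. Qed.

End MeritDirDeriv.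

(** * Convexity of the set of feasible directions *)

Lemma feasible_dir_convex {R : realType} {V : normedModType R}
  (x : V) (S : set V) v w (t : R) : locally_convex_around S x ->
  0 <= t <= 1 -> feasible_dir S x v -> feasible_dir S x w ->
  feasible_dir S x (t *: v + (1 - t) *: w).
Proof.
move=> [r r0 /convex_setP Sconv] t01 [d1 d10 Sv] [d2 d20 Sw].
have [b b0 bP] : exists2 b : R, 0 < b & forall s : R, 0 < s < b ->
    `|x + s *: v - x| <= r /\ `|x + s *: w - x| <= r.
  have near2 : \forall s \near (0 : R)^'+,
      `|x + s *: v - x| <= r /\ `|x + s *: w - x| <= r.
    by apply: filterS2 (near_ray x v r0) (near_ray x w r0) => s.
  have [b b0 bP] := near2.
  exists b => // s /andP[s0 sb]; apply: bP => //=.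
  by rewrite sub0r normrN gtr0_norm.
exists (Num.min b (Num.min d1 d2)) => [|s]; first by rewrite !lt_min b0 d10.
rewrite !lt_min => /and4P[s0 sb sd1 sd2].
have [vr wr] : `|x + s *: v - x| <= r /\ `|x + s *: w - x| <= r.
  by apply: bP; rewrite s0.
rewrite (_ : x + _ = t *: (x + s *: v) + (1 - t) *: (x + s *: w)).
  have [] // := Sconv (x + s *: v) (x + s *: w) t t01.
  - by split; [apply: Sv; rewrite s0|apply/closed_ball_normP].
  - by split; [apply: Sw; rewrite s0|apply/closed_ball_normP].
rewrite !scalerDr addrACA -scalerDl (addrC t) subrK scale1r.
by rewrite !scalerA !(mulrC s).
Qed.

(** * Exact penalization *)

Section ExactPenalty.
Context {R : realType} {X Y Z : normedModType R}.
Variables (K : set Y) (C : set Z) (S : set X) (f : X -> Y) (G : X -> set Z).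
Variables (x : X) (lf : R) (e : Y).
Hypotheses (Kcone : convex_cone K) (Ke : K° e).
Hypotheses (Ccone : convex_cone C) (Cclosed : closed C).
Hypothesis G0 : forall u, G u !=set0.
Hypothesis xmin : local_weakly_efficient f K [set u | S u /\ G u `<=` C] x.
Hypothesis flip : K_lipschitz_near f K x lf e.
Hypothesis Gusc : hausdorff_usc_at G x.

(** Let [m] be the merit of [u]. Membership in [K°] would mean that [f u + c m e] strictly improves
    on [f x]. The feasible [z] of the error bound satisfies [lf |u - z| <= lf m / (a - 1) <= c m],
    so moving to [z] costs at most the penalty and [z] contradicts weak efficiency. *)
Lemma exact_penalty (a c : R) : 1 < a -> C_increasing_with G C S x a ->
  0 <= lf -> lf / (a - 1) <= c ->
  exists2 d : R, 0 < d & forall u, S u -> `|u - x| <= d ->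
    ~ K° (f x - f u - (c * fine (merit G C u)) *: e).
Proof.
move=> a1 Ginc lf0 lc; have a10 : 0 < a - 1 by lra.
have [[_ GxC] [dw dw0 weak]] := xmin.
have [dl dl0 lip] := flip.
have [db db0 bound] := merit_error_bound Ccone Cclosed G0 a1 Ginc.
(* Halved so that [z], within [rho] of a point [u] within [rho] of [x], stays in both balls. *)
pose rho := Num.min dw dl / 2.
have rho0 : 0 < rho by rewrite divr_gt0// lt_min dw0.
have rhow : rho + rho <= dw by rewrite -splitr ge_min lexx.
have rhol : rho + rho <= dl by rewrite -splitr ge_min lexx orbT.
(* The first bound gives [|z - u| <= rho]; the halving in the second gives the strict inequality
   that the error bound requires. *)
pose eps := Num.min (rho * (a - 1)) (db * (a - 1) / 2).
have dba0 : 0 < db * (a - 1) by rewrite mulr_gt0.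
have eps0 : 0 < eps by rewrite /eps lt_min (mulr_gt0 rho0)// divr_gt0.
have [du du0 small] := merit_usc Gusc GxC eps0.
exists (Num.min rho (Num.min db du)) => [|u Su]; first by rewrite !lt_min rho0 db0.
rewrite !le_min => /and3P[urho udb udu] Ku.
have mu : merit G C u = (fine (merit G C u))%:E.
  rewrite fineK// ge0_fin_numE ?merit_ge0//.
  exact: le_lt_trans (small _ udu) (ltry _).
have m0 : 0 <= fine (merit G C u) by rewrite fine_ge0// merit_ge0.
have : fine (merit G C u) <= eps by rewrite -lee_fin -mu; exact: small.
move: (fine _) mu m0 Ku => m mu m0 Ku.
rewrite le_min => /andP[mrho mdb].
have [|z [Sz Gz zu]] := bound u m Su udb mu.
  by rewrite (le_lt_trans mdb)// ltr_pdivrMr// ltr_pMr ?ltr1n// mulr_gt0.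
have zurho : `|z - u| <= rho by rewrite (le_trans zu)// ler_pdivrMr.
have zx : `|z - x| <= rho + rho.
  rewrite (_ : z - x = (z - u) + (u - x)); last by rewrite addrA subrK.
  by rewrite (le_trans (ler_normD _ _))// lerD.
have [||k Kk fuz] := lip u z.
- apply/closed_ball_normP => //; rewrite (le_trans urho)//.
  by rewrite (le_trans _ rhol)// lerDl ltW.
- by apply/closed_ball_normP => //; rewrite (le_trans zx).
have : (f @` ([set u | S u /\ G u `<=` C] `&` closed_ball x dw) `&`
    [set f x - k | k in K°]) (f z).
  split.
    exists z => //; split=> //; apply/closed_ball_normP => //.
    exact: le_trans zx rhow.
  exists (f x - f z); last by rewrite opprB addrC subrK.
  (* The first summand is interior and the rest lies in [K]: the penalty dominates the Lipschitz
     loss, and [k] is the Lipschitz remainder. *)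
  rewrite (_ : f x - f z = (f x - f u - (c * m) *: e) +
      ((c * m - lf * `|u - z|) *: e + k)).
    apply: interior_coneD => //; apply: convex_coneD => //.
    apply: convex_coneZ => //; last exact: interior_subset.
    rewrite subr_ge0 distrC (@le_trans _ _ (lf * (m / (a - 1))))//.
      by rewrite ler_wpM2l.
    by rewrite mulrCA mulrC ler_wpM2r.
  rewrite scalerBl !addrA subrK fuz !opprD !opprK !addrA.
  by rewrite (addrAC _ (- k)) addrK subrK.
by rewrite weak.
Qed.

End ExactPenalty.

(** * Passage to directional derivatives and construction of the multiplier *)

Lemma interior_lim_ray {R : realType} {V : normedModType R} (K : set V)
  (g : R -> V) (y : V) (P : R -> Prop) : convex_cone K -> K° y ->
  t^-1 *: g t @[t --> 0^'+] --> y -> (\forall t \near (0 : R)^'+, P t) ->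
  exists t, P t /\ K° (g t).
Proof.
move=> Kcone Ky gy nearP.
have Kg : \forall t \near (0 : R)^'+, K° (t^-1 *: g t).
  by apply: (gy K°); apply: open_nbhs_nbhs; split=> //; exact: open_interior.
near (0 : R)^'+ => t.
have t0 : 0 < t by near: t; exact: nbhs_right_gt.
exists t; split; first by near: t.
have Kgt : K° (t^-1 *: g t) by near: t.
(* [K°] is stable under positive scaling, so the factor [t^-1] drops out. *)
rewrite -[g t]scale1r -(divff (lt0r_neq0 t0)) -scalerA.
exact: interior_coneZ.
Unshelve. all: by end_near. Qed.

Theorem theorem3p9 (R : realType) (X Y Z : completeNormedModType R)
  (K : set Y) (C : set Z) (S : set X) (f : X -> Y) (G : X -> set Z)
  (xbar : X) (lf : R) (e : Y)
  (hK : convex_cone K) (hKproper : proper_set K) (hKint : K° !=set0)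
  (hC : convex_cone C) (hCclosed : closed C) (hCproper : proper_set C)
  (hC0 : C <> [set 0])
  (hS0 : S !=set0) (hSclosed : closed S)
  (hG0 : forall x, G x !=set0)
  (hxbar : local_weakly_efficient f K [set x | S x /\ G x `<=` C] xbar)
  (hSconv : locally_convex_around S xbar)
  (hlf : 0 < lf) (he : (K° `&` closed_ball (0 : Y) (1 : R)) e)
  (hflip : K_lipschitz_near f K xbar lf e)
  (hfdir : dir_derivable f xbar)
  (hfsub : K_sublinear (dir_deriv f xbar) K)
  (hGlsc : \forall x \near xbar, lsc_at G x)
  (hGinc : metrically_C_increasing G C S xbar)
  (hGbnd : C_bounded_around G C xbar)
  (hGusc : hausdorff_usc_at G xbar)
  (hGconc : C_concave G C) :
  forall alpha l : R, 1 < alpha -> (alpha%:E < incC G C S xbar)%E -> lf <= l ->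
    exists ys : {linear Y -> R^o},
      [/\ dual_cone K ys, (ys : Y -> R) <> (fun=> 0)
        & forall v, feasible_dir S xbar v ->
            exists2 d : R, is_merit_dir_deriv G C xbar v d &
              0 <= (ys (dir_deriv f xbar v) : R)
                   + l / (alpha - 1) * (ys (d *: e) : R)].
Proof.
(* The supremum provides some [a > alpha] with the increase property, and then
   [lf / (a - 1) <= l / (alpha - 1)]. *)
move=> {hC0} alpha l alpha1 /ereal_sup_gt[_ [a [a1 Ginc] <-]]; rewrite lte_fin => aa ll.
have alpha0 : 0 < alpha - 1 by lra.
have [Ke _] := he.
have [[Sx GxC] _] := hxbar.
set c := l / (alpha - 1).
have c0 : 0 <= c by rewrite divr_ge0; lra.
have lc : lf / (a - 1) <= c.
  apply: (@le_trans _ _ (lf / (alpha - 1))); last first.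
    by rewrite ler_wpM2r// invr_ge0 ltW.
  by rewrite ler_wpM2l ?(ltW hlf)// lef_pV2 ?posrE; lra.
have [d d0 penalty] :=
  exact_penalty hK Ke hC hCclosed hG0 hxbar hflip hGusc a1 Ginc (ltW hlf) lc.
pose D := merit_dir_deriv G C xbar.
pose h v := dir_deriv f xbar v + (c * D v) *: e.
have h_ndescent v : feasible_dir S xbar v -> ~ K° (- h v).
  move=> [b b0 Sv] Kh.
  (* As the merit vanishes at [xbar], [t^-1 g t] is minus the penalized difference quotient. *)
  pose g t := f xbar - f (xbar + t *: v) -
    (c * fine (merit G C (xbar + t *: v))) *: e.
  have gh : t^-1 *: g t @[t --> 0^'+] --> - h v.
    rewrite (_ : (fun t => _) = fun t => - (diff_quot f xbar v t) -
        (c * merit_quot G C xbar v t) *: e); last first.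
      apply/funext => t; rewrite /g /diff_quot /merit_quot scalerBr.
      rewrite -[in RHS]scalerN opprB.
      by rewrite scalerA mulrCA.
    rewrite /h opprD; apply: cvgB; first by apply: cvgN; exact: hfdir.
    apply: cvgZr_tmp; apply: cvgMl_tmp.
    exact: (merit_quot_cvg hC hGconc hG0 GxC hGusc).
  have nearS : \forall t \near (0 : R)^'+,
      S (xbar + t *: v) /\ `|xbar + t *: v - xbar| <= d.
    near=> t; split; last by near: t; exact: near_ray.
    by apply: Sv; apply/andP; split; near: t;
      [exact: nbhs_right_gt|exact: nbhs_right_lt].
  have [t [[St td] Kg]] := interior_lim_ray hK Kh gh nearS.
  exact: penalty St td Kg.
have h0 : h 0 = 0.
  (* Homogeneity covers positive factors, so the value at 0 comes from [f'(0) = 2 f'(0)]. *)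
  have [hom _] := hfsub; have := hom 2 0 (ltr0n _ 2).
  rewrite scaler0 => /eqP; rewrite eq_sym -subr_eq0 scaler_nat mulr2n addrK.
  move=> /eqP f0; rewrite /h f0 /D (merit_dir_deriv0 hG0 GxC) mulr0 scale0r addr0.
  by [].
have h_convex v w (t : R) : 0 <= t <= 1 ->
    K (t *: h v + (1 - t) *: h w - h (t *: v + (1 - t) *: w)).
  move=> t01; have [_ /convex_setP fconv] := hfsub.
  have K0 := convex_cone0 hK.
  have := fconv (v, dir_deriv f xbar v) (w, dir_deriv f xbar w) t t01.
  rewrite /cone_le/= !subrr => /(_ K0 K0) Kf.
  have KD : K ((c * (t * D v + (1 - t) * D w - D (t *: v + (1 - t) *: w))) *: e).
    apply: convex_coneZ => //; last exact: interior_subset.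
    by rewrite mulr_ge0// subr_ge0; exact: merit_dir_deriv_convex.
  rewrite (_ : _ - h _ = (t *: dir_deriv f xbar v + (1 - t) *: dir_deriv f xbar w
    - dir_deriv f xbar (t *: v + (1 - t) *: w)) +
    (c * (t * D v + (1 - t) * D w - D (t *: v + (1 - t) *: w))) *: e).
    exact: convex_coneD.
  rewrite /h !scalerDr !scalerA addrACA opprD [LHS]addrACA; congr (_ + _).
  by rewrite -scalerDl -scalerBl; congr (_ *: _); ring.
(* Adding [K] to the values of [h] absorbs the convexity gap, so that [Q] is convex, and makes [e]
   an interior point of [Q]. *)
pose Q := [set y | exists (s : R) v k,
  [/\ 0 <= s, feasible_dir S xbar v, K k & y = s *: (h v + k)]].
have feas0 : feasible_dir S xbar 0 by exists 1 => // t _; rewrite scaler0 addr0.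
have KQ : K `<=` Q.
  by move=> k Kk; exists 1, 0, k; split=> //; rewrite h0 add0r scale1r.
have Qcone : convex_cone Q.
  apply: convex_coneI.
  - exact: KQ (convex_cone0 hK).
  - move=> _ _ [s [v [k [s0 Sv Kk ->]]]] [t [w [j [t0 Sw Kj ->]]]].
    have [st0|st0] := eqVneq (s + t) 0.
      have -> : s = 0 by lra.
      have -> : t = 0 by lra.
      by rewrite !scale0r addr0; exact: KQ (convex_cone0 hK).
    have {}st0 : 0 < s + t by rewrite lt_neqAle eq_sym st0 addr_ge0.
    pose p := s / (s + t).
    have p01 : 0 <= p <= 1.
      by rewrite divr_ge0 ?(ltW st0)//= ler_pdivrMr// mul1r lerDl.
    have ps : (s + t) * p = s by rewrite mulrC divfK ?gt_eqF.
    have pt : (s + t) * (1 - p) = t by rewrite mulrBr ps mulr1 addrC addKr.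
    (* The [K]-part collects the convexity gap of [h] and the combination of [k] and [j]. *)
    exists (s + t), (p *: v + (1 - p) *: w),
      ((p *: h v + (1 - p) *: h w - h (p *: v + (1 - p) *: w)) +
        (p *: k + (1 - p) *: j)); split.
    + exact: ltW.
    + exact: feasible_dir_convex.
    + apply: convex_coneD; [by []|exact: h_convex|].
      by case/andP: p01 => p0 p1; apply: convex_coneD => //;
        apply: convex_coneZ => //; rewrite subr_ge0.
    + rewrite addrA (addrC (h (_ + _))) subrK addrACA -!scalerDr.
      by rewrite [RHS]scalerDr !scalerA ps pt.
  - move=> _ t t0 [s [v [k [s0 Sv Kk ->]]]].
    by exists (t * s), v, k; rewrite scalerA mulr_ge0// ltW.
(* For [s = 0] the relation forces [e = 0], impossible for an interior point of a proper cone; for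
   [s > 0] it puts [- h v = s^-1 e + k] in [K°], against [h_ndescent]. *)
have QNe : ~ Q (- e).
  move=> [s [v [k [s0 Sv Kk]]]]; move: s0; rewrite le_eqVlt => /orP[/eqP<-|s0].
    rewrite scale0r => /eqP; rewrite oppr_eq0 => /eqP e0.
    by apply: (interior_cone_neq0 hK hKproper); rewrite -e0.
  move=> eE; apply: (h_ndescent v Sv).
  rewrite (_ : - h v = s^-1 *: e + k).
    by apply: interior_coneD => //; apply: interior_coneZ => //; rewrite invr_gt0.
  rewrite -(opprK e) eE scalerN scalerA mulVf ?gt_eqF// scale1r.
  by rewrite (opprD _ k) subrK.
have [phi [phic phiQ phie]] := cone_separation Qcone (interiorS KQ Ke) QNe.
exists phi; split.
- by split=> // y /KQ /phiQ.
- move=> phi0; have : (phi e : R) = 0 by rewrite phi0.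
  by rewrite phie => /eqP; rewrite oner_eq0.
move=> v Sv; exists (D v); first exact: merit_dir_derivP.
have /phiQ : Q (h v).
  by exists 1, v, 0; rewrite addr0 scale1r; split=> //; exact: convex_cone0.
rewrite /h linearD !linearZ/=.
by rewrite -[_ *: phi e]/((c * D v) * phi e) -mulrA.
Unshelve. all: by end_near. Qed.
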